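(* For all $d,n\in\mathbb{N}$ we have $$E_d(n)\le\bigl\lfloor dn(1-n^{-1/d})\bigr\rfloor .$$ For each fixed $d$ this bound is asymptotically tight as $n\to\infty$, that is, $\lim_{n\to\infty} E_d(n)/\lfloor dn(1-n^{-1/d})\rfloor = 1$; and equality holds for all $d$-th powers $n=m^d$, $m\in\mathbb{N}$.
   Context: $\mathbb{N}=\{1,2,3,\ldots\}$. The grid graph $\mathbb{Z}^d$ has vertex set $\mathbb{Z}^d$, with $\tilde{x},\tilde{y}$ adjacent iff $\sum_{i=1}^d|x_i-y_i|=1$. For finite $S\subseteq\mathbb{Z}^d$, $E_d(S)$ is the number of edges of the subgraph induced by $S$, and $E_d(n)=\max\{E_d(S): S\subseteq\mathbb{Z}^d,\ |S|=n\}$. *)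

(* Defs.v *)
From HB Require Import structures.
From mathcomp Require Export all_boot all_order all_algebra finmap.
From mathcomp Require Export all_classical all_reals all_analysis.
Export Order.TTheory GRing.Theory Num.Theory.
Export numFieldNormedType.Exports.

Set Implicit Arguments.
Unset Strict Implicit.
Unset Printing Implicit Defensive.

Local Open Scope fset_scope.
Local Open Scope ring_scope.

Definition grid_adj d (x y : 'rV[int]_d) : bool :=
  \sum_(i < d) `|x ord0 i - y ord0 i| == 1 :> int.

(* Edges are the unordered pairs {x, y}, so each edge is counted once. *)
Definition induced_edges d (S : {fset 'rV[int]_d}) : {fset {fset 'rV[int]_d}} :=
  [fset [fset x; y] | x in S, y in S & grid_adj x y].

Definition edge_count d (S : {fset 'rV[int]_d}) : nat :=
  #|` induced_edges S |.

Definition is_max_edge_count d (n k : nat) : Prop :=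
  (exists2 S : {fset 'rV[int]_d}, #|` S| = n & edge_count S = k) /\
  (forall S : {fset 'rV[int]_d}, #|` S| = n -> (edge_count S <= k)%N).

(* The default value 0 is used only if there is no S with n elements, which by
   max_edge_countP does not happen when 0 < d. *)
Definition max_edge_count (d n : nat) : nat :=
  xget 0%N [set k | is_max_edge_count d n k]%classic.

Lemma grid_adj_sym d (x y : 'rV[int]_d) : grid_adj x y = grid_adj y x.
Proof. by rewrite /grid_adj; under eq_bigr do rewrite distrC. Qed.

Lemma grid_adj_irr d (x : 'rV[int]_d) : grid_adj x x = false.
Proof. by rewrite /grid_adj big1 // => i _; rewrite subrr normr0. Qed.

Lemma edge_count_le d (S : {fset 'rV[int]_d}) : (edge_count S <= 2 ^ #|` S|)%N.
Proof.
rewrite -card_fpowerset; apply/fsubset_leq_card/fsubsetP => e.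
case/imfset2P => x xS [y]; rewrite inE => /andP[yS _] ->.
by rewrite fpowersetE; apply/fsubsetP => z; rewrite !inE => /orP[]/eqP->.
Qed.

Lemma exists_fset_card d n : (0 < d)%N ->
  exists S : {fset 'rV[int]_d}, #|` S| = n.
Proof.
case: d => // d _.
pose f (i : nat) : 'rV[int]_d.+1 := const_mx i%:Z.
have f_inj : injective f by move=> i j /rowP /(_ ord0); rewrite !mxE => -[].
exists [fset f i | i in iota 0 n].
by rewrite card_imfset //= undup_id ?size_iota ?iota_uniq.
Qed.

Lemma max_edge_countP d n : (0 < d)%N ->
  is_max_edge_count d n (max_edge_count d n).
Proof.
move=> d0; apply: (@xgetPex _ 0%N [set k | is_max_edge_count d n k]%classic).
pose P k := `[< exists2 S : {fset 'rV[int]_d}, #|` S| = n & edge_count S = k >].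
have exP : exists k, P k.
  have [S Sn] := exists_fset_card n d0.
  by exists (edge_count S); apply/asboolP; exists S.
have ubP k : P k -> (k <= 2 ^ n)%N.
  by move/asboolP => [S <- <-]; exact: edge_count_le.
case: (ex_maxnP exP ubP) => k /asboolP Pk max_k; exists k; split => // S Sn.
by apply: max_k; apply/asboolP; exists S.
Qed.

Definition edge_bound (R : realType) (d n : nat) : int :=
  Num.floor (d%:R * n%:R * (1 - n%:R `^ (- d%:R^-1)) : R).

(* Main.v *)
(* The edges in direction [e_i] correspond to the points x of S with x + e_i in
   S. Upper bound: by induction on the number of directions, with n = |S|, cut S
   into slices orthogonal to [e_j]. If M is the size of the projection of S
   along [e_j], every slice has at most M points, and at least M points of S
   have no successor in direction [e_j]. Writing M = u^k, the k other directions
   contribute at most k (n - n/u) edges by induction, and Bernoulli's inequality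
   gives k n/u + u^k >= (k + 1) n/s when n <= s^(k + 1). Lower bound: the cube
   with m^d points has d m^(d - 1) (m - 1) edges; for m^d <= n < (m + 1)^d this
   makes the ratio at least ((m - 1)/(m + 1))^d >= 1 - 2 d/(m + 1). *)
Require Import Defs.
From mathcomp Require Import zify lra ring.

Set Implicit Arguments.
Unset Strict Implicit.
Unset Printing Implicit Defensive.

Local Open Scope fset_scope.
Local Open Scope ring_scope.

(** * Edges sorted by direction *)

Section DirectedEdges.
Variable d : nat.
Implicit Types (S : {fset 'rV[int]_d}) (x y : 'rV[int]_d) (i j : 'I_d).

Definition unit_step i : 'rV[int]_d := delta_mx ord0 i.

Definition edge_sources S i : {fset 'rV[int]_d} :=
  [fset x in S | x + unit_step i \in S].

Lemma unit_stepE i j : unit_step i ord0 j = (j == i)%:R.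
Proof. by rewrite mxE eqxx. Qed.

Lemma in_edge_sources S i x :
  (x \in edge_sources S i) = (x \in S) && (x + unit_step i \in S).
Proof. by rewrite !inE. Qed.

Lemma unit_step_inj : injective unit_step.
Proof.
move=> i j /rowP/(_ i); rewrite !unit_stepE eqxx.
by case: eqP => // _ /eqP; rewrite oner_eq0.
Qed.

Lemma unit_stepD_neq0 i j : unit_step i + unit_step j != 0.
Proof.
apply/eqP => /rowP/(_ i); rewrite mxE !unit_stepE mxE eqxx.
by case: eqP.
Qed.

Lemma unit_step_neq0 i : unit_step i != 0.
Proof.
apply/eqP => /rowP/(_ i); rewrite unit_stepE mxE eqxx.
by move/eqP; rewrite oner_eq0.
Qed.

Lemma grid_adj_step x i : grid_adj x (x + unit_step i).
Proof.
rewrite /grid_adj (bigD1 i) //= big1 => [|j ji]; rewrite mxE unit_stepE.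
  by rewrite eqxx addr0 opprD addNKr normrN normr1.
by rewrite (negPf ji) addr0 subrr normr0.
Qed.

(** Nonnegative integers with sum 1 are all 0 except for a single 1, so exactly one coordinate
    changes, by 1 up or down. *)
Lemma grid_adjP x y :
  reflect (exists i, y = x + unit_step i \/ x = y + unit_step i) (grid_adj x y).
Proof.
apply: (iffP idP); last first.
  by move=> [i [] ->]; rewrite ?grid_adj_step // grid_adj_sym grid_adj_step.
move=> /eqP xy1.
have [i xyi] : exists i, x ord0 i != y ord0 i.
  have [i xyi|xy] := pickP (fun i => x ord0 i != y ord0 i); first by exists i.
  move: xy1; rewrite big1 // => j _.
  by move/negbFE/eqP: (xy j) => ->; rewrite subrr normr0.
move: xy1; rewrite (bigD1 i) //=; set s := \sum_(_ | _) _ => xy1.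
have s0 : 0 <= s by apply: sumr_ge0.
have xyi1 : `|x ord0 i - y ord0 i| = 1.
  have : 0 < `|x ord0 i - y ord0 i| by rewrite normr_gt0 subr_eq0.
  lia.
have /eqP : s = 0 by lia.
rewrite psumr_eq0// => /allP s_eq0.
have xyj j : j != i -> x ord0 j = y ord0 j.
  move=> ji; have := s_eq0 j (mem_index_enum _); rewrite ji /=.
  by rewrite normr_eq0 subr_eq0 => /eqP.
exists i; have [xy|xy] : y ord0 i = x ord0 i + 1 \/ x ord0 i = y ord0 i + 1.
- by lia.
- left; apply/rowP => j; rewrite mxE unit_stepE.
  by have [->//|/xyj->] := eqVneq j i; rewrite addr0.
- right; apply/rowP => j; rewrite mxE unit_stepE.
  by have [->//|/xyj->] := eqVneq j i; rewrite addr0.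
Qed.

(** The source is the endpoint with the smaller coordinate sum: if the endpoints were swapped, the
    two unit steps would add up to 0. *)
Lemma edge_of_source_inj x y i j :
  [fset x; x + unit_step i] = [fset y; y + unit_step j] -> (i, x) = (j, y).
Proof.
move=> xy.
have := fset21 x (x + unit_step i); rewrite xy => /fset2P[xE|xE].
  have := fset22 x (x + unit_step i); rewrite xy xE => /fset2P[/eqP|].
    by rewrite -subr_eq0 addrC addKr (negPf (unit_step_neq0 i)).
  by move/addrI/unit_step_inj ->.
have := fset21 y (y + unit_step j); rewrite -xy => /fset2P[yE|yE].
  move: xE => /eqP; rewrite yE -subr_eq0 opprD addNKr oppr_eq0.
  by rewrite (negPf (unit_step_neq0 _)).
move: xE => /eqP; rewrite yE -subr_eq0 -addrA opprD addNKr oppr_eq0.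
by rewrite (negPf (unit_stepD_neq0 _ _)).
Qed.

Lemma edge_countE S : edge_count S = (\sum_i #|` edge_sources S i|)%N.
Proof.
pose E :=
  [seq [fset x; x + unit_step i] | i <- enum 'I_d, x <- edge_sources S i].
have -> : edge_count S = size E.
  apply/perm_size/uniq_perm.
  - exact: fset_uniq.
  - apply: allpairs_uniq_dep => [|i _|]; [exact: enum_uniq|exact: fset_uniq|].
    by move=> [i x] [j y] _ _ /= /edge_of_source_inj[-> ->].
  move=> e; apply/idP/allpairsPdep.
    case/imfset2P => x /= xS [y]; rewrite !inE /= => /andP[yS].
    case/grid_adjP => i [] E1 ->.
      by exists i, x; rewrite mem_enum in_edge_sources xS -E1.
    by exists i, y; rewrite mem_enum in_edge_sources yS -E1 fsetUC.
  case=> i [x [_]]; rewrite in_edge_sources => /andP[xS yS] ->.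
  apply/imfset2P; exists x => //; exists (x + unit_step i) => //.
  by rewrite !inE yS grid_adj_step.
by rewrite size_allpairs_dep sumnE big_map big_enum.
Qed.

Lemma edge_sourcesS S S' i :
  S `<=` S' -> edge_sources S i `<=` edge_sources S' i.
Proof.
move=> /fsubsetP sub; apply/fsubsetP => x.
by rewrite !in_edge_sources => /andP[/sub-> /sub->].
Qed.

Lemma edge_countS S S' : S `<=` S' -> (edge_count S <= edge_count S')%N.
Proof.
move=> sub; rewrite !edge_countE; apply: leq_sum => i _.
exact/fsubset_leq_card/edge_sourcesS.
Qed.

End DirectedEdges.

(** * Bernoulli's inequality and counting by fibers *)

Lemma bernoulli_ineq (R : realDomainType) (n : nat) (x : R) :
  -1 <= x -> 1 + n%:R * x <= (1 + x) ^+ n.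
Proof.
move=> x1; elim: n => [|n IH]; first by rewrite mul0r addr0 expr0.
have x1_ge0 : 0 <= 1 + x by lra.
rewrite exprS; apply: le_trans (ler_wpM2l x1_ge0 IH).
have : 0 <= n%:R * x ^+ 2 :> R by rewrite mulr_ge0 ?sqr_ge0.
rewrite -natr1; nra.
Qed.

Lemma sum_card_fibers (K J : choiceType) (h : K -> J) (A : {fset K})
    (B : {fset J}) : {in A, forall x, h x \in B} ->
  #|` A| = (\sum_(b <- B) #|` [fset x in A | h x == b]|)%N.
Proof.
move=> hAB.
under eq_bigr do rewrite card_fset_sum1 -big_fset_condE /=.
rewrite (exchange_big_dep predT) //= card_fset_sum1 big_seq [RHS]big_seq.
apply: eq_bigr => x /hAB hx.
rewrite sum1_count (@eq_count _ _ (pred1 (h x))) => [|b]; last exact: eq_sym.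
by rewrite count_uniq_mem ?fset_uniq // hx.
Qed.

(** * Upper bound by slicing *)

Section Upper.
Variable d : nat.
Implicit Types (S : {fset 'rV[int]_d}) (x y : 'rV[int]_d) (i j : 'I_d).

(** Projection along direction [j]; zeroing the coordinate keeps the image in the same ambient
    space. *)
Definition forget j x : 'rV[int]_d := \row_i (if i == j then 0 else x ord0 i).

Lemma forget_step j x t : forget j (x + unit_step j *+ t) = forget j x.
Proof.
apply/rowP => i; rewrite !mxE; case: eqP => // /eqP ij.
by rewrite mulmxnE unit_stepE (negPf ij) mul0rn addr0.
Qed.

(** Otherwise a whole ray from [x] would lie in the finite set [S]. *)
Lemma edge_sources_exit S j x : x \in S ->
  exists t, x + unit_step j *+ t \in S `\` edge_sources S j.
Proof.
move=> xS; apply: contrapT => stay.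
have stayS t : x + unit_step j *+ t \in S.
  elim: t => [|t IH]; first by rewrite mulr0n addr0.
  apply: contrapT => out; apply: stay; exists t.
  rewrite in_fsetD in_edge_sources IH andbT /= -addrA -mulrSr.
  exact/negP.
have step_inj : injective (fun t => x + unit_step j *+ t).
  move=> t u /addrI /rowP /(_ j); rewrite !mulmxnE unit_stepE eqxx.
  by move/eqP; rewrite (eqr_nat int) => /eqP.
have card_le n : (n <= #|` S|)%N.
  have : [fset x + unit_step j *+ t | t in iota 0 n] `<=` S.
    by apply/fsubsetP => _ /imfsetP[t _ ->].
  move/fsubset_leq_card; rewrite card_imfset //=.
  by rewrite undup_id ?size_iota ?iota_uniq.
by have := card_le #|` S|.+1; rewrite ltnn.
Qed.

(* Every line in direction [j] that meets [S] leaves [S] at some point. *)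
Lemma card_edge_sources S j :
  (#|` edge_sources S j| + #|` [fset forget j x | x in S]| <= #|` S|)%N.
Proof.
have sub : edge_sources S j `<=` S.
  by apply/fsubsetP => x; rewrite in_edge_sources => /andP[].
rewrite -[leqRHS](cardfsID (edge_sources S j)) (fsetIidPr sub) leq_add2l.
set T := S `\` _.
have : [fset forget j x | x in S] `<=` [fset forget j x | x in T].
  apply/fsubsetP => _ /imfsetP[x /= xS ->].
  have [t xt] := edge_sources_exit j xS.
  by apply/imfsetP; exists (x + unit_step j *+ t) => //; rewrite forget_step.
by move/fsubset_leq_card/leq_trans; apply; exact: leq_imfset_card.
Qed.

Definition slice S j (a : int) := [fset x in S | x ord0 j == a].

Lemma card_slice_forget S j a :
  (#|` slice S j a| <= #|` [fset forget j x | x in S]|)%N.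
Proof.
have /card_in_imfset : {in slice S j a &, injective (forget j)}.
  move=> x y; rewrite !inE => /andP[_ /eqP xa] /andP[_ /eqP ya] /rowP xy.
  apply/rowP => i; move: (xy i); rewrite !mxE.
  by case: eqP => [->|//]; rewrite xa ya.
move=> /(_ imfset_key) <-.
apply/fsubset_leq_card/fsubsetP => _ /imfsetP[x /= + ->].
by rewrite !inE => /andP[xS _]; apply: in_imfset.
Qed.

Lemma edge_sources_slice S i j a : i != j ->
  edge_sources (slice S j a) i = [fset x in edge_sources S i | x ord0 j == a].
Proof.
move=> ij; apply/fsetP => x; rewrite !inE /= mxE unit_stepE [j == i]eq_sym.
rewrite (negPf ij) addr0.
by case: (x ord0 j == a); rewrite ?(andbT, andbF).
Qed.

(** [I] contains the directions in which [S] may vary, so the ambient dimension stays fixed: passing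
    to a slice just removes [j] from [I]. Leaving [s] free, instead of taking the exact root of the
    size, lets all slices share the same [u]. *)
Lemma edge_sources_upper (R : realType) (I : {set 'I_d}) S (s : R) :
  {in S &, forall x y i, i \notin I -> x ord0 i = y ord0 i} ->
  0 < s -> #|` S|%:R <= s ^+ #|I| ->
  (\sum_(i in I) #|` edge_sources S i|)%:R
    <= #|I|%:R * (#|` S|%:R - #|` S|%:R / s).
Proof.
move: {2}#|I| (erefl #|I|) => k.
elim: k => [|k IH] in I S s * => Ik agree s0 cardS.
  move/eqP: Ik; rewrite cards_eq0 => /eqP ->.
  by rewrite big_set0 cards0 mul0r.
(* A nonempty [S] is required below to have [M] and [u] positive. *)
have [S0|/fset0Pn[x0 x0S]] := eqVneq S fset0.
  have -> : (\sum_(i in I) #|` edge_sources S i|)%N = 0%N.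
    apply: big1 => i _; apply/eqP; rewrite cardfs_eq0; apply/eqP/fsetP => x.
    by rewrite in_edge_sources S0 inE.
  by rewrite S0 cardfs0 mul0r subrr mulr0.
have [j jI] : exists j, j \in I by apply/set0Pn; rewrite -card_gt0 Ik.
pose I' := (I :\ j)%SET; have I'k : #|I'| = k.
  by move: (cardsD1 j I); rewrite jI Ik => -[].
pose P := [fset forget j x | x in S]; pose M := #|` P|.
have M_gt0 : (0 < M)%N.
  by rewrite cardfs_gt0; apply/fset0Pn; exists (forget j x0); apply: in_imfset.
pose u : R := if k == 0%N then 1 else M%:R `^ k%:R^-1.
have u_gt0 : 0 < u.
  by rewrite /u; case: ifP => // _; rewrite powR_gt0 // ltr0n.
have uM : u ^+ k = M%:R.
  rewrite /u; case: eqP => [k0|/eqP k0].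
    (* For [k = 0] the points of [S] differ only in coordinate [j], so they project to a single
       point. *)
    rewrite expr1n; suff -> : M = 1%N by [].
    apply/eqP; rewrite eqn_leq M_gt0 andbT -(cardfs1 (forget j x0)).
    apply/fsubset_leq_card/fsubsetP => _ /imfsetP[x /= xS ->].
    rewrite inE; apply/eqP/rowP => i; rewrite !mxE; case: eqP => // ij.
    apply: agree => //; apply: contraPN k0 => iI.
    have : i \in I' by rewrite !inE iI andbT; apply/eqP.
    by rewrite -I'k (cardD1 i) => ->.
  by rewrite -powR_mulrn ?powR_ge0 // -powRrM mulVf ?powRr1 ?pnatr_eq0.
pose A : {fset int} := [fset x ord0 j | x : 'rV[int]_d in S].
have hA : {in S, forall x, x ord0 j \in A} by move=> x xS; apply: in_imfset.
have cardSE : #|` S| = (\sum_(a <- A) #|` slice S j a|)%N.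
  exact: sum_card_fibers.
have slices_le : (\sum_(i in I') #|` edge_sources S i|)%:R
    <= k%:R * (#|` S|%:R - #|` S|%:R / u).
  (* A step in a direction other than [j] stays within its slice. *)
  have -> : (\sum_(i in I') #|` edge_sources S i|)%N =
      (\sum_(a <- A) \sum_(i in I') #|` edge_sources (slice S j a) i|)%N.
    rewrite exchange_big; apply: eq_bigr => i; rewrite !inE => /andP[ij _].
    under eq_bigr do rewrite edge_sources_slice //.
    by apply: sum_card_fibers => x; rewrite in_edge_sources => /andP[/hA].
  rewrite natr_sum {1 2}cardSE natr_sum mulr_suml -sumrB mulr_sumr.
  apply: ler_sum => a _; rewrite -I'k; apply: IH => //.
    move=> x y; rewrite !inE => /andP[xS /eqP xa] /andP[yS /eqP ya] i.
    rewrite !inE negb_and negbK.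
    by move=> /orP[/eqP->|iI]; [rewrite xa ya|exact: agree].
  by rewrite I'k uM ler_nat card_slice_forget.
have := card_edge_sources S j; rewrite -/P -/M -(ler_nat R) natrD.
rewrite (big_setD1 j) //= natrD Ik.
set N : R := #|` S|%:R in cardS slices_le *.
set a := #|` edge_sources S j|%:R; set b := (\sum_(_ in _) _)%:R in slices_le *.
(* The slices contribute at most [k (N - N/u)] and direction [j] at most [N - M]. *)
suff : k.+1%:R * (N / s) <= k%:R * (N / u) + M%:R.
  rewrite -natr1; lra.
have N_ge0 : 0 <= N by [].
have us_ge : -1 <= u / s - 1 by rewrite lerBrDr addNr divr_ge0 ?ltW.
(* This says [(k + 1) u/s - k <= (u/s)^(k + 1)]; multiplying by [N/u] and using [N <= s^(k + 1)]
   gives the claim. *)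
have := bernoulli_ineq k.+1 us_ge; rewrite (addrC 1 (_ - 1)) subrK => bern.
have NsM : N / u * (u / s) ^+ k.+1 <= M%:R.
  have -> : N / u * (u / s) ^+ k.+1 = u ^+ k * (N / s ^+ k.+1).
    by rewrite expr_div_n (exprS u); field; rewrite expf_neq0 ?gt_eqF.
  rewrite -uM ler_piMr ?exprn_ge0 ?(ltW u_gt0) //.
  by rewrite ler_pdivrMr ?exprn_gt0 // mul1r -Ik.
have Nu_ge0 : 0 <= N / u by rewrite divr_ge0 // ltW.
apply: le_trans (lerD (lexx _) NsM).
rewrite -[k%:R * _]mulrC -mulrDr.
have -> : N / s = N / u * (u / s) by rewrite mulrA divfK ?gt_eqF.
rewrite mulrCA ler_wpM2l //.
move: bern; rewrite -natr1; lra.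
Qed.

Lemma edge_count_upper (R : realType) S : (0 < d)%N -> (0 < #|` S|)%N ->
  (edge_count S)%:R
    <= d%:R * #|` S|%:R * (1 - #|` S|%:R `^ (- d%:R^-1)) :> R.
Proof.
move=> d0 S0; rewrite edge_countE.
rewrite (eq_bigl [in [set: 'I_d]%SET]) => [|i]; last by rewrite inE.
(* With [s = n^(1/d)], the quotient [n/s] is [n n^(-1/d)]. *)
have := @edge_sources_upper R [set: 'I_d]%SET S (#|` S|%:R `^ d%:R^-1).
rewrite cardsT card_ord powRN -mulrA [_%:R * (1 - _)]mulrBr mulr1; apply.
- by move=> x y _ _ i; rewrite inE.
- by rewrite powR_gt0 // ltr0n.
- by rewrite -powR_mulrn ?powR_ge0 // -powRrM mulVf ?powRr1 ?pnatr_eq0 -?lt0n.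
Qed.

End Upper.

(** * Lower bound from cubes *)

Section Lower.
Variable d : nat.
Implicit Types S : {fset 'rV[int]_d}.

(** Points are added one at a time: a set with more points than [T] always supplies one outside
    [T]. *)
Lemma exists_superset_card S n : (0 < d)%N -> (#|` S| <= n)%N ->
  exists2 T : {fset 'rV[int]_d}, S `<=` T & #|` T| = n.
Proof.
move=> d0; elim: n => [|n IH]; first by rewrite leqn0 => /eqP; exists S.
rewrite leq_eqVlt => /orP[/eqP Sn|]; first by exists S.
rewrite ltnS => /IH[T ST Tn].
have [U Un] := exists_fset_card n.+1 d0.
have /fsubsetPn[x _ xT] : ~~ (U `<=` T).
  by apply/negP => /fsubset_leq_card; rewrite Tn Un ltnn.
exists (x |` T); last by rewrite cardfsU1 xT Tn.
exact: fsubset_trans (fsubsetU1 _ _).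
Qed.

Lemma max_edge_count_ge S n : (0 < d)%N -> (#|` S| <= n)%N ->
  (edge_count S <= max_edge_count d n)%N.
Proof.
move=> d0 /(exists_superset_card d0)[T ST Tn].
have [_ maxE] := max_edge_countP n d0.
exact: leq_trans (edge_countS ST) (maxE T Tn).
Qed.

Definition cube_point m (f : {ffun 'I_d -> 'I_m}) : 'rV[int]_d :=
  \row_i (f i : nat)%:Z.

Lemma cube_point_inj m : injective (@cube_point m).
Proof.
move=> f g /rowP fg; apply/ffunP => i; apply: val_inj.
by move: (fg i); rewrite !mxE => -[].
Qed.

Definition cube m : {fset 'rV[int]_d} :=
  [fset cube_point f | f in {: {ffun 'I_d -> 'I_m}}].

Lemma card_cube m : #|` cube m| = (m ^ d)%N.
Proof.
rewrite card_imfset; last exact: cube_point_inj.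
by rewrite /= -cardE card_ffun !card_ord.
Qed.

(** Every point whose coordinate [i] is not maximal is a source: [m - 1] choices there, [m] in each
    other coordinate. *)
Lemma card_edge_sources_cube m (i : 'I_d) :
  (m ^ d.-1 * m.-1 <= #|` edge_sources (cube m) i|)%N.
Proof.
case: m => [|m]; first by rewrite muln0.
pose F (j : 'I_d) : pred 'I_m.+1 := if j == i then predC1 ord_max else predT.
have <- : #|(family F : simpl_pred _)| = (m.+1 ^ d.-1 * m)%N.
  rewrite card_family foldrE big_map big_enum (bigD1 i) //= mulnC; congr muln.
    rewrite (eq_bigr (fun=> m.+1)) => [|j /negPf ji].
      by rewrite prod_nat_const cardC1 card_ord.
    by rewrite /F ji card_ord.
  by rewrite /F eqxx cardC1 card_ord.
rewrite -cardsE cardE; set FF := [set f in _]%SET.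
have <- : #|` [fset cube_point f | f in FF]| = size (enum FF).
  by rewrite card_imfset //; apply: cube_point_inj.
apply/fsubset_leq_card/fsubsetP => _ /imfsetP[f /= + ->].
rewrite inE => /familyP/(_ i); rewrite /F eqxx inE => fi.
rewrite in_edge_sources in_imfset //=.
pose g : {ffun 'I_d -> 'I_m.+1} :=
  [ffun j => if j == i then inord (f i).+1 else f j].
suff -> : cube_point f + unit_step i = cube_point g by rewrite in_imfset.
(* This bound ensures that [inord] returns the intended value and not its default. *)
have fi_lt : ((f i).+1 < m.+1)%N.
  rewrite ltnS ltn_neqAle -ltnS ltn_ord andbT.
  by apply: contra fi => /eqP fi; apply/eqP/val_inj.
apply/rowP => j; rewrite mxE unit_stepE !mxE ffunE.
by case: eqP => [->|_]; [rewrite inordK //= -PoszD addn1|rewrite addr0].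
Qed.

Lemma max_edge_count_lower m n : (0 < d)%N -> (m ^ d <= n)%N ->
  (d * (m ^ d.-1 * m.-1) <= max_edge_count d n)%N.
Proof.
move=> d0; rewrite -card_cube => /(max_edge_count_ge d0); apply: leq_trans.
rewrite edge_countE -[X in (X * _)%N]card_ord -sum_nat_const.
by apply: leq_sum => i _; apply: card_edge_sources_cube.
Qed.

End Lower.

(** * The floor bound, equality at powers, and the limit *)

Section Bound.
Variables (R : realType) (d : nat).
Hypothesis d0 : (0 < d)%N.

Lemma max_edge_count_le n : (0 < n)%N ->
  (max_edge_count d n)%:Z <= edge_bound R d n.
Proof.
move=> n0; have [[S Sn <-] _] := max_edge_countP n d0.
rewrite floor_ge_int; apply: le_trans (edge_count_upper R d0 _) _; rewrite ?Sn//.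
Qed.

(** For [n = m^d] the real bound is the integer [d m^(d - 1) (m - 1)], which the cube attains. *)
Lemma max_edge_count_pow m : (0 < m)%N ->
  (max_edge_count d (m ^ d))%:Z = edge_bound R d (m ^ d).
Proof.
move=> m0; apply/le_anti; rewrite max_edge_count_le ?expn_gt0 ?m0 //=.
have low := max_edge_count_lower d0 (leqnn (m ^ d)).
rewrite -(ler_int R); apply: le_trans (floor_le _) _.
rewrite -pmulrn; apply: le_trans (_ : (d * (m ^ d.-1 * m.-1))%:R <= _); last first.
  by rewrite ler_nat.
have -> : (m ^ d)%:R `^ (- d%:R^-1) = m%:R^-1 :> R.
  rewrite powRN natrX -powR_mulrn // -powRrM mulfV ?pnatr_eq0 -?lt0n //.
  by rewrite powRr1.
rewrite -[X in (m ^ X)%N](prednK d0) expnS !natrM -[m.-1]subn1 natrB //.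
by rewrite le_eqVlt; apply/orP; left; apply/eqP; field; rewrite pnatr_eq0 -lt0n.
Qed.

Lemma cvg_edge_ratio :
  (((max_edge_count d n)%:R / (edge_bound R d n)%:~R : R) @[n --> \oo]
     --> (1 : R))%classic.
Proof.
apply/cvgrPdist_le => e e0.
(* Chosen so that [m >= m0] gives both [2 d/(m + 1) <= e] and [m >= 2]; the latter makes the edge
   count, hence also the denominator, positive. *)
pose m0 := (Num.truncn (2 * d%:R / e)).+2.
exists (m0 ^ d)%N => // n /= m0n.
have root_bound k : (k ^ d <= n)%N -> (k <= n)%N.
  by apply: leq_trans; case: k => // k; rewrite -{1}(expn1 k.+1) leq_pexp2l.
(* Here [m] becomes the integer part of the [d]-th root of [n]. *)
case: (ex_maxnP (ex_intro (fun k => k ^ d <= n)%N m0 m0n) root_bound).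
move=> m mn max_m.
have m0m : (m0 <= m)%N := max_m _ m0n.
have nm : (n < m.+1 ^ d)%N by rewrite ltnNge; apply/negP => /max_m; rewrite ltnn.
have n0 : (0 < n)%N by apply: leq_trans m0n; rewrite expn_gt0.
have m1_gt0 : 0 < m.+1%:R :> R by rewrite ltr0n.
(* Weakening [m^(d - 1)] to [(m - 1)^(d - 1)] makes the ratio bound a pure [d]-th power, ready for
   Bernoulli. *)
have low : (d * m.-1 ^ d <= max_edge_count d n)%N.
  apply: leq_trans (max_edge_count_lower d0 mn).
  rewrite leq_mul2l -[X in (m.-1 ^ X)%N](prednK d0) expnSr.
  rewrite leq_mul2r; case: (posnP d.-1) => [->|k0]; first by rewrite !orbT.
  by rewrite leq_exp2r // leq_pred !orbT.
have EB := max_edge_count_le n0.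
set E := max_edge_count d n in low EB *; set B := edge_bound R d n in EB *.
rewrite -(ler_int R) -pmulrn in EB.
have E0 : 0 < E%:R :> R.
  rewrite ltr0n; apply: leq_trans low; rewrite muln_gt0 d0 expn_gt0.
  by rewrite -ltnS prednK (leq_trans _ m0m).
have B0 : 0 < B%:~R :> R := lt_le_trans E0 EB.
have Bup : B%:~R <= d%:R * (m.+1 ^ d)%:R :> R.
  apply: le_trans (floor_le _) _.
  apply: le_trans (_ : d%:R * n%:R <= _).
    by rewrite ler_piMr ?mulr_ge0// gerBl powR_ge0.
  by rewrite -!natrM ler_nat leq_mul2l (ltnW nm) orbT.
have small : 2 * d%:R / m.+1%:R <= e.
  rewrite ler_pdivrMr // [e * _]mulrC -ler_pdivrMr //.
  apply: le_trans (ltW (truncnS_gt _)) _.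
  by rewrite ler_nat (leq_trans _ (leqW m0m)).
(* The ratio is at most 1 by [EB], so only its lower bound remains. *)
rewrite ger0_norm ?subr_ge0 ?ler_pdivrMr ?mul1r //.
rewrite lerBlDr -lerBlDl; apply: le_trans (_ : 1 - 2 * d%:R / m.+1%:R <= _).
  by rewrite lerB.
have [pm1 pm2] : -1 <= - (2 / m.+1%:R) :> R /\
    1 - 2 / m.+1%:R = m.-1%:R / m.+1%:R :> R.
  have m_ge1 : (1 <= m)%N by apply: leq_trans m0m.
  split; last first.
    by rewrite -subn1 natrB // -[m.+1%:R]natr1; field; rewrite natr1 pnatr_eq0.
  by rewrite lerN2 ler_pdivrMr // mul1r (ler_nat R 2).
(* Bernoulli at [-2/(m + 1)] gives [1 - 2 d/(m + 1) <= ((m - 1)/(m + 1))^d]. *)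
have := bernoulli_ineq d pm1; rewrite pm2 => bern.
apply: le_trans (_ : (m.-1%:R / m.+1%:R) ^+ d <= _).
  by apply: le_trans bern; rewrite mulrN mulrA [d%:R * 2]mulrC.
rewrite ler_pdivlMr //; apply: le_trans (ler_wpM2l _ Bup) _.
  by rewrite exprn_ge0 // divr_ge0.
rewrite expr_div_n natrX mulrCA divfK ?expf_neq0 ?gt_eqF //.
by rewrite -natrX -natrM ler_nat.
Qed.

End Bound.

Local Open Scope classical_set_scope.
Local Open Scope ring_scope.

Theorem proposition3p2 (R : realType) :
  (forall d n : nat, (0 < d)%N -> (0 < n)%N ->
     (max_edge_count d n)%:Z <= edge_bound R d n) /\
  (forall d : nat, (0 < d)%N ->
     ((max_edge_count d n)%:R / (edge_bound R d n)%:~R : R) @[n --> \oo]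
       --> (1 : R)) /\
  (forall d m : nat, (0 < d)%N -> (0 < m)%N ->
     (max_edge_count d (m ^ d))%:Z = edge_bound R d (m ^ d)).
Proof.
split=> [d n d0|]; first exact: max_edge_count_le.
by split=> [d d0|d m d0]; [exact: cvg_edge_ratio|exact: max_edge_count_pow].
Qed.
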